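(* Let $n\ge 4$ and let $f:[1,\infty)^2\to\mathbb{R}$ be a symmetric function, $f(x,y)=f(y,x)$, satisfying: (i) $f(x,y)$ is strictly increasing in $x$; (ii) $f(x+y-1,1)>f(x,y)$ for all $x,y\ge 2$. Then for every $G\in\mathbb{U}_{n,2}$, $$\mathrm{BID}(G)\le \mathrm{BID}(S_n^+)=(n-3)f(1,n-1)+2f(2,n-1)+f(2,2),$$ with equality if and only if $G\cong S_n^+$.
   Context: All graphs are finite, simple, undirected and connected; $d(u)$ is the degree of the vertex $u$. For a symmetric real-valued function $f$, the bond incident degree index of a graph $G$ is $\mathrm{BID}(G)=\sum_{uv\in E(G)} f(d(u),d(v))$. A unicyclic graph is a connected graph containing exactly one cycle; $\mathbb{U}_{n,d}$ is the set of unicyclic graphs with $n$ vertices and diameter $d$. $S_n^+$ is the graph obtained from a triangle $C_3$ by attaching $n-3$ pendant vertices (new vertices of degree 1) to one of its vertices. *)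

(* Defs.v *)
From HB Require Import structures.
From mathcomp Require Import all_boot all_order all_algebra.
From mathcomp Require Import reals.

Set Implicit Arguments.
Unset Strict Implicit.
Unset Printing Implicit Defensive.

Import Order.TTheory GRing.Theory Num.Theory.

Record sgraph := SGraph {
  vertex :> finType;
  adj : rel vertex;
  adj_sym : symmetric adj;
  adj_irrefl : irreflexive adj
}.

Definition deg (G : sgraph) (u : G) : nat := #|[set v | adj u v]|.

Definition connected (G : sgraph) : Prop :=
  forall x y : G, connect (@adj G) x y.

(* The edges of a cyclic sequence, as unordered pairs. Rotating or reversing
   the sequence does not change them, so a cycle, as a subgraph, is
   represented by its edge set. *)
Definition cycle_edges (G : sgraph) (c : seq G) : {set {set G}} :=
  [set [set x; next c x] | x in c].

Definition is_cycle (G : sgraph) (C : {set {set G}}) : Prop :=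
  exists c : seq G, [/\ 2 < size c, ucycle (@adj G) c & C = cycle_edges c].

Definition unicyclic (G : sgraph) : Prop :=
  connected G /\ exists! C : {set {set G}}, is_cycle C.

(* The least length of a walk from x to y. A shortest walk has length < #|G|,
   so the search is exhaustive; the value is #|G| if there is no walk. *)
Definition dist (G : sgraph) (x y : G) : nat :=
  find (fun k => [exists p : k.-tuple G, path (@adj G) x p && (last x p == y)])
       (iota 0 #|G|).

Definition diam (G : sgraph) : nat :=
  \max_(x : G) \max_(y : G) dist x y.

Definition in_U (n d : nat) (G : sgraph) : Prop :=
  [/\ unicyclic G, #|G| = n & diam G = d].

Definition isomorphic (G H : sgraph) : Prop :=
  exists2 phi : G -> H, bijective phi &
    forall x y : G, adj (phi x) (phi y) = adj x y.

Definition triangle_adj : rel 'I_3 := fun i j => i != j.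

Lemma triangle_adj_sym : symmetric triangle_adj.
Proof. by move=> i j; rewrite /triangle_adj eq_sym. Qed.

Lemma triangle_adj_irrefl : irreflexive triangle_adj.
Proof. by move=> i; rewrite /triangle_adj eqxx. Qed.

Definition triangle : sgraph := SGraph triangle_adj_sym triangle_adj_irrefl.

Definition attach_adj (G : sgraph) (v : G) (k : nat) : rel (G + 'I_k)%type := fun a b =>
  match a, b with
  | inl x, inl y => adj x y
  | inl x, inr _ => x == v
  | inr _, inl y => y == v
  | inr _, inr _ => false
  end.

Lemma attach_adj_sym (G : sgraph) (v : G) (k : nat) :
  symmetric (@attach_adj G v k).
Proof. by move=> [x|i] [y|j] //=; exact: adj_sym. Qed.

Lemma attach_adj_irrefl (G : sgraph) (v : G) (k : nat) :
  irreflexive (@attach_adj G v k).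
Proof. by move=> [x|i] //=; exact: adj_irrefl. Qed.

Definition attach_pendants (G : sgraph) (v : G) (k : nat) : sgraph :=
  SGraph (@attach_adj_sym G v k) (@attach_adj_irrefl G v k).

(* Truncated subtraction: this has n vertices only for n >= 3. *)
Definition S_plus (n : nat) : sgraph :=
  @attach_pendants triangle (ord0 : 'I_3) (n - 3).

Local Open Scope ring_scope.

(* The condition on ranks selects one of the two orientations of each edge, so
   that each edge is counted once. See BID_ordered_pairs: for symmetric f the
   choice is immaterial. *)
Definition BID (R : realType) (f : R -> R -> R) (G : sgraph) : R :=
  \sum_(p : G * G | adj p.1 p.2 && (enum_rank p.1 < enum_rank p.2)%N)
    f (deg p.1)%:R (deg p.2)%:R.

Lemma deg_gt0 (G : sgraph) (u v : G) : adj u v -> (0 < deg u)%N.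
Proof. by move=> uv; apply/card_gt0P; exists v; rewrite inE. Qed.

Lemma BID_ordered_pairs (R : realType) (f : R -> R -> R) (G : sgraph) :
  (forall x y, 1 <= x -> 1 <= y -> f x y = f y x) ->
  BID f G *+ 2 = \sum_(p : G * G | adj p.1 p.2) f (deg p.1)%:R (deg p.2)%:R.
Proof.
move=> fC.
rewrite [RHS](bigID (fun p : G * G => (enum_rank p.1 < enum_rank p.2)%N)) /=.
rewrite mulr2n; congr (_ + _).
rewrite /BID (reindex (fun p : G * G => (p.2, p.1))) /=; last first.
  by exists (fun p : G * G => (p.2, p.1)) => -[].
apply: eq_big => [[x y]|[x y] /= /andP[xy _]] /=.
  rewrite adj_sym; case xy: (adj x y) => //=.
  rewrite -leqNgt [RHS]leq_eqVlt.
  case: (altP (enum_rank y =P enum_rank x)) => [/enum_rank_inj yx|/negPf nyx].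
    by rewrite yx adj_irrefl in xy.
  by rewrite -[X in _ = X || _]/(enum_rank y == enum_rank x) nyx.
have yx := xy; rewrite adj_sym in yx.
by apply: fC; rewrite ler1n; [exact: deg_gt0 xy | exact: deg_gt0 yx].
Qed.

(* Main.v *)
Require Import Defs.
From HB Require Import structures.
From mathcomp Require Import all_boot all_order all_algebra.
From mathcomp Require Import reals.
From mathcomp Require Import ring lra.

Set Implicit Arguments.
Unset Strict Implicit.
Unset Printing Implicit Defensive.

Import Order.TTheory GRing.Theory Num.Theory.
Local Open Scope ring_scope.

(** A unicyclic graph G of diameter 2 with n >= 4 vertices either contains a
    triangle, and is then S_plus n, or is triangle-free, and is then 2-regular.
    Uniqueness of the cycle is exploited through its vertex set: two cycles
    with different vertex sets cannot coexist.

    Suppose that a, b, c is a triangle. Any cycle through a vertex outside it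
    is a contradiction. Since vertices are at distance at most 2, a vertex
    outside the triangle that has no neighbor in it, or two neighbors in it,
    lies on a cycle of length 3 or 5 ([outside_has_neighbor],
    [outside_one_neighbor]); two outside vertices attached to different
    vertices of the triangle lie on a cycle of length 4 or 5
    ([outside_same_neighbor]); and two adjacent outside vertices attached to
    the same one form a second triangle. So everything outside is pendant at a
    single vertex of the triangle ([triangle_isomorphic_S_plus]).

    Suppose that there is no triangle. If all the neighbors of u were a single
    vertex v, distance at most 2 would make v adjacent to everything, G would
    be a star and have no cycle ([triangle_free_deg_ge2]). If u had three
    neighbors a, b, c, then going away from a and coming back to u through b or
    through c would give two cycles with different vertex sets
    ([triangle_free_regular]). Hence all degrees are 2 and BID(G) = n f(2,2).

    The second kind of graph has the strictly smaller index: the merging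
    hypothesis gives f(2,2) < f(3,1), so by monotonicity f(2,2) < f(1,n-1) and
    f(2,2) < f(2,n-1), and these replace all but one of the n copies of f(2,2).
    Equality therefore forces the first kind, and the converse is the
    invariance of the index under isomorphism. Sums over edges are handled
    after doubling, as sums over ordered pairs of adjacent vertices, which need
    no choice of orientation. *)

(** * Cycles and short walks *)

Definition simple_cycle (G : sgraph) (c : seq G) : bool :=
  [&& (2 < size c)%N, cycle (@adj G) c & uniq c].

(** The form in which uniqueness of the cycle is used: a cycle is compared
    with another one by exhibiting a vertex that is on one only. *)
Definition equicyclic (G : sgraph) : Prop :=
  forall c c' : seq G, simple_cycle c -> simple_cycle c' -> c =i c'.

(** Diameter at most 2, stated with the witnesses that build cycles. *)
Definition two_step (G : sgraph) : Prop :=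
  forall x y : G, x != y -> adj x y \/ exists2 z, adj x z & adj z y.

Definition is_triangle (G : sgraph) (a b c : G) : bool :=
  [&& adj a b, adj b c & adj a c].

Lemma adj_neq (G : sgraph) (x y : G) : adj x y -> x != y.
Proof. by move=> xy; apply/eqP => e; rewrite e adj_irrefl in xy. Qed.

(** The edge set of a cycle determines its vertex set. *)
Lemma cover_cycle_edges (G : sgraph) (c : seq G) :
  cover (cycle_edges c) = [set x in c].
Proof.
apply/setP => x; rewrite inE; apply/bigcupP/idP => [[A /imsetP[y yc ->]]|xc].
  by rewrite !inE => /orP[] /eqP->; rewrite ?mem_next.
by exists [set x; next c x]; [apply/imsetP; exists x | rewrite !inE eqxx].
Qed.

Lemma unicyclic_equicyclic (G : sgraph) : unicyclic G -> equicyclic G.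
Proof.
move=> [_ [C [_ uniqC]]] c c' /and3P[c3 cc uc] /and3P[c'3 cc' uc'] x.
have eC : C = cycle_edges c by apply: uniqC; exists c; split=> //; apply/andP.
have eC' : C = cycle_edges c' by apply: uniqC; exists c'; split=> //; apply/andP.
have := cover_cycle_edges c; rewrite -eC eC' cover_cycle_edges.
by move/setP/(_ x); rewrite !inE.
Qed.

Lemma unicyclic_has_cycle (G : sgraph) :
  unicyclic G -> exists c : seq G, simple_cycle c.
Proof.
by move=> [_ [C [[c [c3 /andP[cc uc] _]] _]]]; exists c; apply/and3P.
Qed.

(** The bound on the order makes the search that defines [dist] succeed when
    its value is at most 2, since failure is reported by the value [#|G|]. *)
Lemma diam2_two_step (G : sgraph) : (2 < #|G|)%N -> diam G = 2%N -> two_step G.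
Proof.
move=> G3 diam2 x y xy.
have dxy : (dist x y <= 2)%N.
  rewrite -diam2; apply: leq_trans (leq_bigmax x).
  exact: (@leq_bigmax _ (fun y => dist x y) y).
have dG : (dist x y < #|G|)%N by apply: leq_ltn_trans dxy G3.
have := dG; rewrite {1}/dist -[X in (_ < X)%N](size_iota 0) -has_find.
move/(nth_find 0%N); rewrite nth_iota // -/(dist x y) add0n.
case/existsP => -[p /= /eqP sp]; rewrite -sp in dxy.
case: p dxy {sp} => [|z [|t [|? ?]]] //= _; first by rewrite (negPf xy).
  by case/andP => /andP[xz _] /eqP <-; left.
by case/andP => /and3P[xz zt _] /eqP <-; right; exists z.
Qed.

(** * Graphs with a triangle *)

(** Every contradiction in this part comes from here: a second cycle would have
    to have the same vertex set as the triangle. *)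
Lemma no_cycle_leaves_triangle (G : sgraph) (a b c x : G) (p : seq G) :
  equicyclic G -> is_triangle a b c -> x \notin [:: a; b; c] ->
  x \in p -> ~~ simple_cycle p.
Proof.
move=> eqG /and3P[ab bc ac] xT xp; apply/negP => sp.
have sT : simple_cycle [:: a; b; c].
  rewrite /simple_cycle /= ab bc adj_sym ac !inE !negb_or.
  by rewrite (adj_neq ab) (adj_neq bc) (adj_neq ac).
by rewrite (eqG _ _ sT sp) xp in xT.
Qed.

Lemma is_triangle_rot (G : sgraph) (a b c : G) :
  is_triangle a b c -> is_triangle b c a.
Proof. by case/and3P=> ab bc ac; apply/and3P; split=> //; rewrite adj_sym. Qed.

Lemma is_triangle_swap (G : sgraph) (a b c : G) :
  is_triangle a b c -> is_triangle a c b.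
Proof. by case/and3P=> ab bc ac; apply/and3P; split=> //; rewrite adj_sym. Qed.

(** Otherwise x, a, b is another triangle. *)
Lemma outside_one_neighbor (G : sgraph) (a b c x : G) :
  equicyclic G -> is_triangle a b c -> x \notin [:: a; b; c] ->
  adj x a -> ~~ adj x b.
Proof.
move=> eqG T xT xa; apply/negP => xb.
have /and3P[ab _ _] := T.
have /negP := no_cycle_leaves_triangle (p := [:: x; a; b]) eqG T xT (mem_head _ _).
apply; rewrite /simple_cycle /= xa ab adj_sym xb !inE !negb_or.
by rewrite (adj_neq xa) (adj_neq xb) (adj_neq ab).
Qed.

(** Otherwise x, a, b, y is a 4-cycle if x and y are adjacent, and closes up
    to a 5-cycle through a common neighbor of x and y if they are not. *)
Lemma outside_same_neighbor (G : sgraph) (a b c x y : G) :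
  equicyclic G -> two_step G -> is_triangle a b c ->
  x \notin [:: a; b; c] -> y \notin [:: a; b; c] ->
  adj x a -> ~~ adj y b.
Proof.
move=> eqG tsG T xT yT xa; apply/negP => yb.
have /and3P[ab _ _] := T.
have T' : is_triangle b a c by apply/is_triangle_swap/is_triangle_rot.
have yT' : y \notin [:: b; a; c] by move: yT; rewrite !inE orbCA.
have xNb := outside_one_neighbor eqG T xT xa.
have yNa := outside_one_neighbor eqG T' yT' yb.
have xy : x != y by apply: contraNneq yNa => <-.
have xb : x != b by apply: contraNneq xT => ->; rewrite !inE eqxx orbT.
have ya : y != a by apply: contraNneq yT => ->; rewrite !inE eqxx.
have no p := no_cycle_leaves_triangle (p := x :: p) eqG T xT (mem_head _ _).
case: (tsG x y xy) => [axy|[z xz zy]].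
  have /negP := no [:: a; b; y]; apply.
  rewrite /simple_cycle /= xa ab (adj_sym b) yb (adj_sym y) axy !inE !negb_or.
  by rewrite (adj_neq xa) (adj_neq ab) xb xy (eq_sym a) ya eq_sym (adj_neq yb).
have za : z != a by apply: contraNneq yNa => <-; rewrite adj_sym.
have zb : z != b by apply: contraNneq xNb => <-.
have /negP := no [:: a; b; y; z]; apply.
rewrite /simple_cycle /= xa ab (adj_sym b) yb (adj_sym y) zy (adj_sym z) xz.
rewrite !inE !negb_or (adj_neq xa) (adj_neq ab) xb xy (adj_neq xz) /=.
by rewrite !(eq_sym a) ya za !(eq_sym b) (adj_neq yb) zb eq_sym (adj_neq zy).
Qed.

(** If x is adjacent to neither a nor b, it has a common neighbor y with a and
    z with b. When y and z differ, x, y, a, b, z is a 5-cycle; when they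
    coincide, y is adjacent to both a and b, which forces y = c. *)
Lemma outside_has_neighbor (G : sgraph) (a b c x : G) :
  equicyclic G -> two_step G -> is_triangle a b c ->
  x \notin [:: a; b; c] -> [|| adj x a, adj x b | adj x c].
Proof.
move=> eqG tsG T xT; have /and3P[ab _ _] := T.
have [xa|xNa] //= := boolP (adj x a); have [xb|xNb] //= := boolP (adj x b).
have := xT; rewrite !inE !negb_or => /and3P[xa xb _].
case: (tsG x a xa) => [|[y xy ya]]; first by rewrite (negPf xNa).
case: (tsG x b xb) => [|[z xz zb]]; first by rewrite (negPf xNb).
have yb : y != b by apply: contraNneq xNb => <-.
have za : z != a by apply: contraNneq xNa => <-.
have [yz|yz] := eqVneq y z.
  have [<- //|yc] := eqVneq y c.
  have yT : y \notin [:: a; b; c] by rewrite !inE !negb_or (adj_neq ya) yb yc.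
  by have := outside_one_neighbor eqG T yT ya; rewrite yz zb.
have /negP[] :=
  no_cycle_leaves_triangle (p := [:: x; y; a; b; z]) eqG T xT (mem_head _ _).
rewrite /simple_cycle /= xy ya ab (adj_sym b) zb (adj_sym z) xz !inE !negb_or.
rewrite (adj_neq xy) xa xb (adj_neq xz) (adj_neq ya) yb yz (adj_neq ab).
by rewrite (eq_sym a) za eq_sym (adj_neq zb).
Qed.

(** The isomorphism is built from S_plus to G, where both parts of the sum type
    have an obvious image, and is bijective by injectivity and counting. *)
Lemma isomorphic_S_plus (G : sgraph) (a b c : G) :
  is_triangle a b c ->
  (forall x, x \notin [:: a; b; c] -> [&& adj x a, ~~ adj x b & ~~ adj x c]) ->
  (forall x y, x \notin [:: a; b; c] -> y \notin [:: a; b; c] -> ~~ adj x y) ->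
  isomorphic G (S_plus #|G|).
Proof.
move=> T toA indep; have /and3P[ab bc ac] := T.
pose O := [set x | x \notin [:: a; b; c]].
have uT : uniq [:: a; b; c].
  by rewrite /= !inE negb_or (adj_neq ab) (adj_neq bc) (adj_neq ac).
have cT : #|[set x in [:: a; b; c]]| = 3%N.
  by rewrite cardsE; apply/card_uniqP.
have cO : #|O| = (#|G| - 3)%N.
  rewrite -(cardsC [set x in [:: a; b; c]]) cT addKn; apply: eq_card => x.
  by rewrite !inE.
have G3 : (3 <= #|G|)%N by rewrite -cT max_card.
pose psi (s : S_plus #|G|) : G :=
  match s with
  | inl i => nth a [:: a; b; c] (i : 'I_3)
  | inr j => enum_val (cast_ord (esym cO) j)
  end.
have psiO j : psi (inr j) \notin [:: a; b; c].
  by have := enum_valP (cast_ord (esym cO) j); rewrite inE.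
have psiT i : psi (inl i) \in [:: a; b; c] by apply: mem_nth; case: i.
have inj_psi : injective psi.
  move=> [i|i] [j|j] e.
  - by move/eqP: e; rewrite /= nth_uniq ?ltn_ord // => /eqP/val_inj->.
  - by have := psiO j; rewrite -e psiT.
  - by have := psiO i; rewrite e psiT.
  by congr inr; exact/(@cast_ord_inj _ _ (esym cO))/enum_val_inj.
have [phi psiK phiK] : bijective psi.
  apply: inj_card_bij inj_psi _.
  by rewrite card_sum !card_ord subnKC.
exists phi; first by exists psi.
have adj_psi s t : adj s t = adj (psi s) (psi t).
  case: s t => [i|i] [j|j].
  - case: i j => [[|[|[|//]]] ?] [[|[|[|//]]] ?] //=;
      rewrite /triangle_adj -(inj_eq val_inj) /= ?adj_irrefl ?ab ?bc ?ac //;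
      by rewrite adj_sym ?ab ?bc ?ac.
  - have /and3P[xa xb xc] := toA _ (psiO j).
    rewrite [RHS]adj_sym; case: i => [[|[|[|//]]] ?];
    by rewrite /= -(inj_eq val_inj) /= ?xa ?(negPf xb) ?(negPf xc).
  - have /and3P[xa xb xc] := toA _ (psiO i).
    case: j => [[|[|[|//]]] ?];
    by rewrite /= -(inj_eq val_inj) /= ?xa ?(negPf xb) ?(negPf xc).
  by rewrite (negPf (indep _ _ (psiO i) (psiO j))).
by move=> x y; rewrite adj_psi !phiK.
Qed.

(** Any outside vertex x tells which vertex of the triangle carries all the
    pendant vertices: the neighbor of x. *)
Lemma triangle_isomorphic_S_plus (G : sgraph) (a b c x : G) :
  equicyclic G -> two_step G -> is_triangle a b c ->
  x \notin [:: a; b; c] -> isomorphic G (S_plus #|G|).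
Proof.
move=> eqG tsG.
(* By rotating the triangle, the neighbor of x is taken to be its first vertex. *)
suff main a' b' c' : is_triangle a' b' c' -> x \notin [:: a'; b'; c'] ->
    adj x a' -> isomorphic G (S_plus #|G|).
  move=> T xT; have T' := is_triangle_rot T; have T'' := is_triangle_rot T'.
  have rotE : [:: b; c; a] = rot 1 [:: a; b; c] by [].
  have rotE' : [:: c; a; b] = rot 2 [:: a; b; c] by [].
  case/or3P: (outside_has_neighbor eqG tsG T xT); first exact: main T xT.
    by apply: main T' _; rewrite rotE mem_rot.
  by apply: main T'' _; rewrite rotE' mem_rot.
move=> {a b c} T xT xa; have T' := is_triangle_swap T.
have swapT y : (y \in [:: a'; c'; b']) = (y \in [:: a'; b'; c']).
  by rewrite !inE orbA orbAC -orbA.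
have toA y : y \notin [:: a'; b'; c'] ->
    [&& adj y a', ~~ adj y b' & ~~ adj y c'].
  move=> yT; have := outside_has_neighbor eqG tsG T yT.
  have yb := outside_same_neighbor eqG tsG T xT yT xa.
  have yc : ~~ adj y c'.
    by apply: (outside_same_neighbor (x := x) eqG tsG T'); rewrite ?swapT.
  by rewrite yb yc (negPf yb) (negPf yc) !orbF => ->.
apply: (isomorphic_S_plus T toA) => y z yT zT; apply/negP => yz.
have /andP[ya _] := toA y yT; have /andP[za _] := toA z zT.
have /negP[] := no_cycle_leaves_triangle (p := [:: y; z; a']) eqG T yT (mem_head _ _).
rewrite /simple_cycle /= yz za adj_sym ya !inE !negb_or.
by rewrite (adj_neq yz) (adj_neq ya) (adj_neq za).
Qed.

(** * Triangle-free graphs *)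

(** A vertex u whose only neighbor is v makes v adjacent to every other vertex,
    because v is the only possible midpoint of a walk of length 2 from u.
    Without triangles every edge then contains v, whereas a cycle of length at
    least 4 has two disjoint edges. *)
Lemma triangle_free_deg_ge2 (G : sgraph) (u : G) (c : seq G) :
  (1 < #|G|)%N -> two_step G -> (forall a b c : G, ~~ is_triangle a b c) ->
  simple_cycle c -> (1 < deg u)%N.
Proof.
move=> G1 tsG noT sc; rewrite ltnNge; apply/negP => du.
have [w wu] : exists w, w != u.
  by case/card_gt1P: G1 => x [y [_ _ xy]]; have [e|] := eqVneq x u;
    [exists y; rewrite -e eq_sym | exists x].
have [v uv] : exists v, adj u v.
  by rewrite eq_sym in wu; case: (tsG u w wu) => [|[z]]; [exists w|exists z].
have only v' : adj u v' -> v' = v.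
  by move=> uv'; apply: (card_le1_eqP du); rewrite inE.
have all_v x : x != v -> adj x v.
  move=> xv; have [->//|xu] := eqVneq x u.
  case: (tsG x u xu) => [xu'|[z xz zu]].
    by rewrite (only x) ?eqxx // adj_sym in xv.
  by rewrite -(only z) // adj_sym.
have edge_v x y : adj x y -> (x == v) || (y == v).
  move=> xy; apply/negPn; rewrite negb_or; apply/negP => /andP[xv yv].
  by have /negP[] := noT x y v; apply/and3P; rewrite xy !all_v.
case: c sc => [|x [|y [|z [|t s]]]] /and3P[//= _].
  case/and4P=> xy yz zx _; have /negP[] := noT x y z.
  by rewrite /is_triangle xy yz adj_sym.
case/and4P=> xy yz zt _; rewrite !inE !negb_or.
case/and4P=> /and4P[_ xz xt _] /and3P[yz' yt _] _ _.
have := edge_v _ _ xy; have := edge_v _ _ zt.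
by case/orP=> /eqP e /orP[] /eqP e'; move: xz xt yz' yt; rewrite e e' eqxx.
Qed.

(** Let u have three neighbors a, b, c, and let a' be a neighbor of a other
    than u. As a' is not adjacent to u, it reaches b in at most two steps
    avoiding u and a, which gives a cycle u, a, a', b or u, a, a', z, b;
    likewise with c in place of b. Two cycles of different lengths have
    different vertex sets. Two 4-cycles differ since c is not on the first one;
    two 5-cycles can agree only if z = c, but z is adjacent to b while c, which
    shares the neighbor u with b, is not. *)
Lemma triangle_free_regular (G : sgraph) (u : G) :
  (1 < #|G|)%N -> unicyclic G -> two_step G ->
  (forall a b c : G, ~~ is_triangle a b c) -> deg u = 2%N.
Proof.
move=> G1 uG tsG noT; have eqG := unicyclic_equicyclic uG.
have [c0 sc0] := unicyclic_has_cycle uG.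
apply/eqP; rewrite eqn_leq (triangle_free_deg_ge2 u G1 tsG noT sc0) andbT leqNgt.
apply/negP => /card_gt2P[a [b [c [[]]]]]; rewrite !inE => ua ub uc [ab bc ca].
have indep x y : adj u x -> adj u y -> ~~ adj x y.
  move=> ux uy; apply/negP => xy.
  by have /negP[] := noT u x y; apply/and3P.
have /card_gt1P[s [t []]] := triangle_free_deg_ge2 a G1 tsG noT sc0.
rewrite !inE => as_ at_ st.
have [a' aa' a'u] : exists2 a', adj a a' & a' != u.
  by have [e|] := eqVneq s u; [exists t; rewrite // -e eq_sym | exists s].
have a'Nu : ~~ adj a' u by apply: contraL aa' => a'u'; rewrite indep // adj_sym.
have closing x : x != a -> adj u x -> adj a' x \/
    exists z, [/\ adj z x, z \notin [:: u; a; a'; x] & adj a' z].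
  move=> xa ux; have a'x : a' != x by apply: contraNneq a'Nu => ->; rewrite adj_sym.
  case: (tsG a' x a'x) => [|[z a'z zx]]; [by left | right; exists z; split=> //].
  rewrite !inE !negb_or (adj_neq zx) (eq_sym z a') (adj_neq a'z) !andbT.
  apply/andP; split; first by apply: contraNneq a'Nu => <-.
  by apply: contraL zx => /eqP ->; rewrite indep.
have cyc4 x : x != a -> adj u x -> adj a' x -> simple_cycle [:: u; a; a'; x].
  move=> xa ux a'x; rewrite /simple_cycle /= ua aa' a'x adj_sym ux !inE !negb_or.
  by rewrite (adj_neq ua) (adj_neq ux) (adj_neq aa') (adj_neq a'x) !(eq_sym _ x)
    xa (eq_sym u) a'u.
have cyc5 x z : x != a -> adj u x -> adj z x -> z \notin [:: u; a; a'; x] ->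
   adj a' z -> simple_cycle [:: u; a; a'; z; x].
  move=> xa ux zx; rewrite !inE !negb_or => /and4P[zu za za' zx'] a'z.
  rewrite /simple_cycle /= ua aa' a'z zx adj_sym ux !inE !negb_or.
  rewrite (adj_neq ua) (adj_neq ux) (adj_neq aa') (adj_neq a'z) zx'.
  rewrite !(eq_sym _ z) zu za !(eq_sym _ x) xa (eq_sym u) a'u.
  by rewrite /= andbT; apply: contraNneq a'Nu => <-; rewrite adj_sym.
have size_eq (p q : seq G) : simple_cycle p -> simple_cycle q -> size p = size q.
  move=> sp sq; apply/eqP; have e := eqG _ _ sp sq.
  case/and3P: sp => _ _ up; case/and3P: sq => _ _ uq.
  by have := uniq_size_uniq up e; rewrite uq eq_sym => <-.
have cNu : c != u by rewrite eq_sym (adj_neq uc).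
have cNa' : c != a' by apply: contraNneq a'Nu => <-; rewrite adj_sym.
have cb : c != b by rewrite eq_sym.
have ba : b != a by rewrite eq_sym.
case: (closing b ba ub) => [a'b|[z [zb zN a'z]]];
  case: (closing c ca uc) => [a'c|[w [wc wN a'w]]].
- have := eqG _ _ (cyc4 b ba ub a'b) (cyc4 c ca uc a'c) c.
  by rewrite !inE eqxx !orbT (negPf ca) (negPf cNu) (negPf cNa') (negPf cb).
- by have := size_eq _ _ (cyc4 b ba ub a'b) (cyc5 c w ca uc wc wN a'w).
- by have := size_eq _ _ (cyc5 b z ba ub zb zN a'z) (cyc4 c ca uc a'c).
have := eqG _ _ (cyc5 b z ba ub zb zN a'z) (cyc5 c w ca uc wc wN a'w) c.
rewrite !inE eqxx !orbT (negPf ca) (negPf cNu) (negPf cNa') (negPf cb) /= orbF.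
by move/eqP=> cz; have := indep c b uc ub; rewrite cz zb.
Qed.

(** * The index *)

Lemma isomorphic_deg (G H : sgraph) (phi : G -> H) :
  bijective phi -> (forall x y, adj (phi x) (phi y) = adj x y) ->
  forall x, deg (phi x) = deg x.
Proof.
move=> bij_phi adj_phi x; rewrite /deg -(card_imset _ (bij_inj bij_phi)).
have [psi phiK psiK] := bij_phi.
apply: eq_card => y; rewrite -(psiK y) (mem_imset _ _ (bij_inj bij_phi)).
by rewrite !inE adj_phi.
Qed.

Lemma BID_isomorphic (R : realType) (f : R -> R -> R) (G H : sgraph) :
  (forall x y, 1 <= x -> 1 <= y -> f x y = f y x) ->
  isomorphic G H -> BID f G = BID f H.
Proof.
move=> fC [phi bij_phi adj_phi]; apply: (@pmulrnI _ 2%N) => //.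
rewrite !BID_ordered_pairs //.
have [psi phiK psiK] := bij_phi.
rewrite [RHS](reindex (fun p : G * G => (phi p.1, phi p.2))) /=; last first.
  by exists (fun p : H * H => (psi p.1, psi p.2)) => -[x y] _ /=; rewrite ?phiK ?psiK.
apply: eq_big => [[x y]|[x y] _] /=; first by rewrite adj_phi.
by rewrite !(isomorphic_deg bij_phi adj_phi).
Qed.

Lemma BID_degree_sum (R : realType) (f : R -> R -> R) (G : sgraph) :
  (forall x y, 1 <= x -> 1 <= y -> f x y = f y x) ->
  BID f G *+ 2 = \sum_(u : G) \sum_(v : G | adj u v) f (deg u)%:R (deg v)%:R.
Proof.
by move=> fC; rewrite BID_ordered_pairs // pair_big_dep.
Qed.

Lemma BID_regular2 (R : realType) (f : R -> R -> R) (G : sgraph) :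
  (forall x y, 1 <= x -> 1 <= y -> f x y = f y x) ->
  (forall u : G, deg u = 2%N) -> BID f G = #|G|%:R * f 2 2.
Proof.
move=> fC d2; apply: (@pmulrnI _ 2%N) => //; rewrite BID_degree_sum //.
rewrite (eq_bigr (fun=> f 2 2 *+ 2)); last first.
  move=> u _; rewrite (eq_bigr (fun=> f 2 2)); last by move=> v _; rewrite !d2.
  by rewrite sumr_const; congr (_ *+ _); rewrite -(d2 u) /deg cardsE.
by rewrite sumr_const mulr_natl -!mulrnA mulnC.
Qed.

(** Twice the index is the sum over ordered pairs of adjacent vertices: the
    center contributes (n-3) f(n-1,1) + 2 f(n-1,2), each of the two other
    vertices of the triangle f(2,n-1) + f(2,2), and each pendant vertex
    f(1,n-1). *)
Lemma BID_S_plus (R : realType) (f : R -> R -> R) (n : nat) :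
  (3 <= n)%N -> (forall x y, 1 <= x -> 1 <= y -> f x y = f y x) ->
  BID f (S_plus n) =
    (n%:R - 3) * f 1 (n%:R - 1) + 2 * f 2 (n%:R - 1) + f 2 2.
Proof.
move=> n3 fC.
have sumE (F : S_plus n -> nat) : (\sum_v F v =
    F (inl ord0) + F (inl (inord 1)) + F (inl (inord 2)) + \sum_j F (inr j))%N.
  rewrite big_sumType /= !big_ord_recl big_ord0 addn0 !addnA.
  by congr (_ + F (inl _) + F (inl _) + _)%N; apply: val_inj; rewrite /= inordK.
have sumR (F : S_plus n -> R) : \sum_v F v =
    F (inl ord0) + F (inl (inord 1)) + F (inl (inord 2)) + \sum_j F (inr j).
  rewrite big_sumType /= !big_ord_recl big_ord0 addr0 !addrA.
  by congr (_ + F (inl _) + F (inl _) + _); apply: val_inj; rewrite /= inordK.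
have degE (u : S_plus n) : deg u = (\sum_v adj u v)%N.
  by rewrite /deg -sum1dep_card big_mkcond.
have E12 : ((inord 1 : 'I_3) == inord 2) = false by rewrite -val_eqE /= !inordK.
have E10 : ((inord 1 : 'I_3) == ord0) = false by rewrite -val_eqE /= inordK.
have E20 : ((inord 2 : 'I_3) == ord0) = false by rewrite -val_eqE /= inordK.
have E21 : ((inord 2 : 'I_3) == inord 1) = false by rewrite eq_sym.
have E01 : ((ord0 : 'I_3) == inord 1) = false by rewrite eq_sym.
have E02 : ((ord0 : 'I_3) == inord 2) = false by rewrite eq_sym.
have adjE := (E12, E10, E20, E21, E01, E02, eqxx).
have degS := (degE, sumE, big_const_ord, iter_addn).
have d0 : (deg (inl ord0 : S_plus n))%:R = n%:R - 1 :> R.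
  by rewrite !degS /= /triangle_adj !adjE /= mul1n addn0 !natrD natrB //; ring.
have d1 : deg (inl (inord 1) : S_plus n) = 2%N.
  by rewrite !degS /= /triangle_adj !adjE /= mul0n.
have d2 : deg (inl (inord 2) : S_plus n) = 2%N.
  by rewrite !degS /= /triangle_adj !adjE /= mul0n.
have dp j : deg (inr j : S_plus n) = 1%N.
  by rewrite !degS /= !adjE mul0n.
apply: (@pmulrnI _ 2%N) => //; rewrite BID_degree_sum //.
under eq_bigr do rewrite big_mkcond sumR.
rewrite sumR /= /triangle_adj !adjE /= d0 d1 d2.
under eq_bigr do rewrite dp.
under [X in _ + X]eq_bigr do rewrite dp big1 ?addr0 ?add0r //.
rewrite !big_const_ord !iter_addr_0 !mul0rn.
have n1 : 1 <= n%:R - 1 :> R by move: n3; rewrite -(ler_nat R); lra.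
rewrite (fC (n%:R - 1) 1) // (fC (n%:R - 1) 2) //; last by lra.
rewrite -[_ *+ (n - 3)]mulr_natl natrB //.
ring.
Qed.

Theorem theorem3p7 (R : realType) (n : nat) (f : R -> R -> R)
  (hn : (4 <= n)%N)
  (f_sym : forall x y : R, 1 <= x -> 1 <= y -> f x y = f y x)
  (f_incr : forall x x' y : R, 1 <= x -> 1 <= y -> x < x' -> f x y < f x' y)
  (f_merge : forall x y : R, 2 <= x -> 2 <= y -> f x y < f (x + y - 1) 1) :
  BID f (S_plus n) =
    (n%:R - 3) * f 1 (n%:R - 1) + 2 * f 2 (n%:R - 1) + f 2 2 /\
  forall G : sgraph, in_U n 2 G ->
    BID f G <= BID f (S_plus n) /\
    (BID f G = BID f (S_plus n) <-> isomorphic G (S_plus n)).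
Proof.
have bidS := BID_S_plus (ltnW hn) f_sym; split=> // G [uG cG dG].
have G2 : (2 < #|G|)%N by rewrite cG ltnW.
have tsG := diam2_two_step G2 dG.
have [|noT] := boolP [exists a : G, [exists b : G, [exists c : G, is_triangle a b c]]].
  case/existsP=> a /existsP[b /existsP[c T]].
  have [x xT] : exists x, x \notin [:: a; b; c].
    apply/existsP; rewrite -negb_forall; apply/negP => /forallP sT.
    have : (#|G| <= size [:: a; b; c])%N.
      by rewrite (leq_trans _ (card_size _)) // subset_leq_card //; apply/subsetP.
    by rewrite cG leqNgt hn.
  have iso := triangle_isomorphic_S_plus (unicyclic_equicyclic uG) tsG T xT.
  rewrite cG in iso.
  by rewrite (BID_isomorphic f_sym iso).
suff lt : BID f G < BID f (S_plus n).
  split; first exact: ltW.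
  split=> [e|iso]; first by rewrite e ltxx in lt.
  exact: BID_isomorphic.
have noT' (a b c : G) : ~~ is_triangle a b c.
  apply: contra noT => T.
  by apply/existsP; exists a; apply/existsP; exists b; apply/existsP; exists c.
rewrite (BID_regular2 f_sym) => [|u]; last first.
  exact: triangle_free_regular (ltnW G2) uG tsG noT'.
rewrite bidS cG.
have n4 : 4 <= n%:R :> R by rewrite (ler_nat R 4 n).
have lt2 : f 2 2 < f 2 (n%:R - 1).
  by rewrite [ltRHS]f_sym; [apply: f_incr | |]; lra.
(* The weak bound 3 <= n-1 is split, since monotonicity is strict. *)
have lt1 : f 2 2 < f 1 (n%:R - 1).
  have lt31 : f 2 2 < f 3 1.
    by have := f_merge 2 2 (lexx _) (lexx _); rewrite (_ : 2 + 2 - 1 = 3 :> R) //; ring.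
  rewrite [ltRHS]f_sym; [| lra | lra].
  have [e|n3] := eqVneq (n%:R - 1 : R) 3; first by rewrite e.
  apply: (lt_trans lt31); apply: f_incr; [lra | lra |].
  by rewrite lt_neqAle eq_sym n3 /=; lra.
have : 0 < (n%:R - 3) * (f 1 (n%:R - 1) - f 2 2) by apply: mulr_gt0; lra.
lra.
Qed.
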